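(* For every $\epsilon > 0$ there exists $N = N(\epsilon)$ such that for every integer $q \ge N$ the following holds. Let $G$ be a bipartite simple graph with bipartition $A \cup B$, where $|A| = q$ and every vertex of $A$ has degree at least $(1+\epsilon)q$, and suppose the edges of $G$ are properly colored. Then $G$ contains a rainbow matching which covers every vertex of $A$.
   Context: A proper edge-coloring is one in which no two edges sharing a vertex receive the same color. A matching is a set of pairwise vertex-disjoint edges; it is rainbow if its edges have pairwise distinct colors. *)

(* Defs.v *)
From mathcomp Require Import all_boot all_order all_algebra.
From mathcomp Require Import reals.

Set Implicit Arguments.
Unset Strict Implicit.
Unset Printing Implicit Defensive.

Section Graph.
Variables (V : finType) (e : rel V).

Definition simple_graph : Prop := symmetric e /\ irreflexive e.

Definition bipartition (A B : {set V}) : Prop :=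
  [/\ A :|: B = [set: V], [disjoint A & B] &
      forall x y, e x y -> (x \in A /\ y \in B) \/ (x \in B /\ y \in A)].

Definition degree (v : V) : nat := #|[set w | e v w]|.

Definition edges : {set {set V}} :=
  [set [set p.1; p.2] | p : V * V & e p.1 p.2].

(* An edge coloring is a total function on vertex sets; only its values on
   [edges] matter. *)
Definition proper_edge_coloring (C : eqType) (c : {set V} -> C) : Prop :=
  forall f g, f \in edges -> g \in edges ->
    f != g -> f :&: g != set0 -> c f != c g.

Definition matching (M : {set {set V}}) : Prop :=
  M \subset edges /\ trivIset M.

End Graph.

Definition rainbow (V : finType) (C : eqType) (c : {set V} -> C)
    (M : {set {set V}}) : Prop :=
  {in M &, injective c}.

(* Main.v *)
(** Regard an edge as a triple (row in [A], column in [B], colour), any two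
coordinates of which determine the third.

A maximum partial rainbow matching [T] misses only O(1/eps) rows (Woolbright's
argument). Process the missed rows one at a time and collect the columns of [T]
that can be freed, by exchanges with the rows processed so far, without using a
new colour. By maximality the edges of the next missed row in free or freeable
columns have only colours of [T], and the columns of [T] matched to these
colours become freeable; so each missed row adds at least [eps * q] of them,
and there are at most [q].

To cover the missed rows too, sample a few columns and colours at random such
that each row loses only a small proportion of its edges by avoiding them, but
has linearly many edges with both column and colour in the sample. Apply the
first part outside the sample and match the boundedly many missed rows greedily
inside it. *)
Require Import Defs.
From mathcomp Require Import all_boot all_order all_algebra.
From mathcomp Require Import reals.
From mathcomp Require Import zify ring lra.

Set Implicit Arguments.
Unset Strict Implicit.
Unset Printing Implicit Defensive.

Import Order.TTheory GRing.Theory Num.Theory.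
Local Open Scope ring_scope.

(** * Transversals: rainbow matchings as sets of triples *)

Section RainbowTransversals.
Local Open Scope nat_scope.
Variables (X I B C : finType) (r : X -> I) (b : X -> B) (c : X -> C).
Implicit Types (H T : {set X}) (A : {set I}).

Definition transversal T :=
  [/\ {in T &, injective r}, {in T &, injective b} & {in T &, injective c}].

Definition row H a := [set x in H | r x == a].

Lemma transversalS T T' : T' \subset T -> transversal T -> transversal T'.
Proof.
move=> /subsetP sub [tr tb tc]; split=> x y xT yT; [exact: tr (sub _ xT) (sub _ yT)
  |exact: tb (sub _ xT) (sub _ yT)|exact: tc (sub _ xT) (sub _ yT)].
Qed.

Lemma inj_in_setU1 (Y : eqType) (f : X -> Y) T x :
  {in T &, injective f} -> {in T, forall y, f y != f x} ->
  {in x |: T &, injective f}.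
Proof.
move=> injf nf y z /setU1P[->|yT] /setU1P[->|zT] //; last exact: injf.
  by move=> E; have := nf _ zT; rewrite E eqxx.
by move=> E; have := nf _ yT; rewrite E eqxx.
Qed.

Lemma transversalU1 T x : transversal T ->
  {in T, forall y, [/\ r y != r x, b y != b x & c y != c x]} ->
  transversal (x |: T).
Proof.
by move=> [tr tb tc] new; split; apply: inj_in_setU1 => // y /new[].
Qed.

Lemma inj_in_setU (Y : eqType) (f : X -> Y) T T' :
  {in T &, injective f} -> {in T' &, injective f} ->
  {in T & T', forall x y, f x != f y} -> {in T :|: T' &, injective f}.
Proof.
move=> fT fT' ne x y /setUP[xT|xT'] /setUP[yT|yT'] E; first exact: fT.
- by have := ne _ _ xT yT'; rewrite E eqxx.
- by have := ne _ _ yT xT'; rewrite E eqxx.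
- exact: fT'.
Qed.

Lemma transversalU T T' : transversal T -> transversal T' ->
  {in T & T', forall x y, [/\ r x != r y, b x != b y & c x != c y]} ->
  transversal (T :|: T').
Proof.
move=> [tr tb tc] [tr' tb' tc'] new.
by split; apply: inj_in_setU => // x y xT yT'; have [] := new _ _ xT yT'.
Qed.

(** * Woolbright's bound on the rows missed by a maximum transversal *)

Section Deficiency.
Variables (H : {set X}) (A : {set I}) (d : nat).
Hypothesis rb_inj : {in H &, forall x y, r x = r y -> b x = b y -> x = y}.
Hypothesis rc_inj : {in H &, forall x y, r x = r y -> c x = c y -> x = y}.
Hypothesis row_ge : {in A, forall a, d <= #|row H a|}.

Variable T : {set X}.
Hypotheses (TH : T \subset H) (TA : r @: T \subset A) (trT : transversal T).
Hypothesis Tmax : forall T', T' \subset H -> r @: T' \subset A ->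
  transversal T' -> #|T'| <= #|T|.

(* [avoids s b0 G T']: trading rows of [T] for rows in [s] gives [T'], which
   leaves the column [b0] free and uses no new colour; only edges of [T] whose
   column lies in [G] have been dropped. *)
Definition avoids (s : seq I) (b0 : B) (G : {set B}) T' :=
  [/\ T' \subset H /\ transversal T', #|T'| = #|T|,
      {in T', forall x, (r x \in r @: T) || (r x \in s)} /\
      {in T', forall x, c x \in c @: T}, b0 \notin b @: T' &
      {in T :\: T', forall x, b x \in G}].

Lemma freeable_columns (s : seq I) : uniq s ->
  {subset s <= A :\: r @: T} ->
  exists G : {set B}, [/\ G \subset b @: T, size s * (d - #|A|) <= #|G| &
    forall b0, (b0 \notin b @: T) || (b0 \in G) -> exists T', avoids s b0 G T'].
Proof.
have [trr trb trc] := trT.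
elim: s => [_ _|a s IHs /= /andP[as_ us] sA].
  exists set0; split; rewrite ?sub0set // => b0; rewrite inE orbF => b0T.
  exists T; split=> //; first by split=> x xT; rewrite imset_f.
  by move=> x; rewrite setDv inE.
have /setDP[aA aT] : a \in A :\: r @: T by apply: sA; rewrite mem_head.
have [|G [GT Gge Gfree]] := IHs us.
  by move=> x xs; apply: sA; rewrite inE xs orbT.
pose N := [set x in row H a | (b x \notin b @: T) || (b x \in G)].
(* Otherwise [x] extends a transversal [T'] that leaves its column free, against [Tmax]; row [a] is
   new to [T'], as it lies outside [s] and [r @: T]. *)
have NcT x : x \in N -> c x \in c @: T.
  rewrite !inE => /andP[/andP[xH /eqP rx] /Gfree[T' [[T'H trT'] cardT' [rT' cT'] bT' _]]].
  apply: contraT => cx.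
  have new : {in T', forall y, [/\ r y != r x, b y != b x & c y != c x]}.
    move=> y yT'; split.
    - by apply/eqP=> E; move: (rT' y yT'); rewrite E rx (negPf aT) (negPf as_).
    - by apply: contraNneq bT' => <-; rewrite imset_f.
    - by apply: contraNneq cx => <-; exact: cT'.
  have xT' : x \notin T' by apply/negP => /new[]; rewrite eqxx.
  suff: #|x |: T'| <= #|T| by rewrite cardsU1 xT' cardT' ltnn.
  apply: Tmax; last exact: transversalU1.
    by rewrite subUset sub1set xH.
  apply/subsetP=> _ /imsetP[y /setU1P[->|yT'] ->]; first by rewrite rx.
  have /orP[/(subsetP TA)//|ys] := rT' y yT'.
  by have /setDP[] : r y \in A :\: r @: T by apply: sA; rewrite inE ys orbT.
pose G' := [set b y | y in T & c y \in c @: N].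
exists (G :|: G'); split.
- rewrite subUset GT; apply/subsetP=> _ /imsetP[y + ->].
  by rewrite inE => /andP[yT _]; rewrite imset_f.
- have cardG' : #|G'| = #|N|.
    rewrite card_in_imset; last first.
      by move=> y z; rewrite !inE => /andP[yT _] /andP[zT _]; apply: trb.
    have cN : {in N &, injective c}.
      move=> y z; rewrite !inE => /andP[/andP[yH /eqP ry] _] /andP[/andP[zH /eqP rz] _].
      by apply: rc_inj => //; rewrite ry rz.
    rewrite -(card_in_imset cN) -(@card_in_imset _ _ c); last first.
      by move=> y z; rewrite !inE => /andP[yT _] /andP[zT _]; apply: trc.
    apply: eq_card => z; apply/imsetP/idP => [[y]|zN].
      by rewrite inE => /andP[_ cy] ->.
    have /imsetP[x xN zE] := zN; have /imsetP[y yT cy] := NcT x xN.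
    by exists y; rewrite ?inE ?yT -?cy -?zE.
  (* [G] and [G'] may overlap, so the growth comes from [G'] alone: edges of row [a] outside [N] lie
     in distinct columns of [b @: T] outside [G], whence [#|G'| = #|N|] is at least
     [#|G| + d - #|A|]. *)
  have rowN : #|row H a| <= #|N| + (#|b @: T| - #|G|).
    rewrite -(cardsID N); apply: leq_add; first by rewrite subset_leq_card ?subsetIr.
    have bi : {in row H a :\: N &, injective b}.
      move=> y z; rewrite !inE => /andP[_ /andP[yH /eqP ry]] /andP[_ /andP[zH /eqP rz]].
      by apply: rb_inj => //; rewrite ry rz.
    rewrite -(card_in_imset bi) -cardsDS //; apply/subset_leq_card/subsetP.
    move=> _ /imsetP[y + ->]; rewrite !inE => /andP[+ yr]; rewrite yr /=.
    by rewrite negb_or negbK andbC.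
  have bT : #|b @: T| <= #|A|.
    rewrite (leq_trans (leq_imset_card _ _)) // -(card_in_imset trr).
    exact: subset_leq_card.
  have dr := row_ge aA.
  have GG : #|G| <= #|b @: T| by exact: subset_leq_card.
  have G'G : #|G'| <= #|G :|: G'| by exact: subset_leq_card (subsetUr _ _).
  rewrite mulSn; lia.
- move=> b0; rewrite inE orbA => /orP[/Gfree[T' [p1 p2 [p3 p3'] p4 p5]]|].
    exists T'; split=> //; first split=> // x /p3.
      by rewrite inE => /orP[->|->]; rewrite ?orbT.
    by move=> x /p5; rewrite inE => ->.
  case/imsetP=> y; rewrite inE => /andP[yT /imsetP[x xN cyx]] ->.
  have := xN; rewrite !inE => /andP[/andP[xH /eqP rx] /Gfree].
  move=> [T' [[T'H trT'] cardT' [rT' cT'] bT' GT']].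
  (* If [T'] has already dropped [y], the last clause of [avoids] puts its column in [G], and the
     induction hypothesis frees it. *)
  have [yT'|yT'] := boolP (y \in T'); last first.
    have byG : b y \in G by apply: GT'; rewrite inE yT'.
    have [|T2 [p1 p2 [p3 p3'] p4 p5]] := Gfree (b y); first by rewrite byG orbT.
    exists T2; split=> //; first split=> // z /p3.
      by rewrite inE => /orP[->|->]; rewrite ?orbT.
    by move=> z /p5; rewrite inE => ->.
  have [tr' tb' tc'] := trT'.
  have rne z : z \in T' -> r z != r x.
    move=> zT'; apply/eqP=> E.
    by move: (rT' z zT'); rewrite E rx (negPf aT) (negPf as_).
  have bne z : z \in T' -> b z != b x.
    by move=> zT'; apply: contraNneq bT' => <-; rewrite imset_f.
  have xT' : x \notin T' by apply/negP => /rne; rewrite eqxx.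
  (* Trading [y] for [x], of the same colour, frees the column of [y] and brings in row [a]. *)
  exists (x |: T' :\ y); split.
  - split; first by rewrite subUset sub1set xH (subset_trans (subsetDl _ _)).
    apply: transversalU1; first exact: transversalS (subsetDl _ _) trT'.
    move=> z /setD1P[zy zT']; split; [exact: rne|exact: bne|].
    by rewrite -cyx; apply: contra_neq zy => /tc'; apply.
  - rewrite cardsU1 !inE (negPf xT') andbF /= -cardT' (cardsD1 y T') yT'.
    by [].
  - split=> z /setU1P[->|/setD1P[_ zT']].
    + by rewrite rx mem_head orbT.
    + by rewrite inE; have /orP[->|->] := rT' z zT'; rewrite ?orbT.
    + by rewrite -cyx imset_f.
    + exact: cT'.
  - apply/imsetP=> -[z /setU1P[->|/setD1P[zy zT']] E].
      by have := bne y yT'; rewrite E eqxx.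
    by move/eqP: zy; apply; apply: tb'.
  - move=> z /setDP[zT]; rewrite !inE negb_or negb_and negbK.
    move=> /andP[_ /orP[/eqP->|zT']]; apply/orP; [right|left].
      by apply: imset_f; rewrite inE yT cyx imset_f.
    by apply: GT'; rewrite inE zT'.
Qed.

(** All missed rows are processed; the freeable columns are columns of [T], which has at most one
    edge in each row of [A]. *)
Lemma deficiency_maximal : #|A :\: r @: T| * (d - #|A|) <= #|A|.
Proof.
have [|G [GT Gge _]] := @freeable_columns (enum (A :\: r @: T)) (enum_uniq _).
  by move=> x; rewrite mem_enum.
rewrite -cardE in Gge; apply: leq_trans Gge _.
rewrite (leq_trans (subset_leq_card GT)) // (leq_trans (leq_imset_card _ _)) //.
by have [trr _ _] := trT; rewrite -(card_in_imset trr) subset_leq_card.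
Qed.

End Deficiency.

Lemma almost_transversal H A d :
  {in H &, forall x y, r x = r y -> b x = b y -> x = y} ->
  {in H &, forall x y, r x = r y -> c x = c y -> x = y} ->
  {in A, forall a, d <= #|row H a|} ->
  exists T, [/\ T \subset H, r @: T \subset A, transversal T &
    #|A :\: r @: T| * (d - #|A|) <= #|A|].
Proof.
move=> rb rc rowd.
pose ok (T : {set X}) := [&& T \subset H, r @: T \subset A,
  dinjectiveb r (mem T), dinjectiveb b (mem T) & dinjectiveb c (mem T)].
have okP T : reflect [/\ T \subset H, r @: T \subset A & transversal T] (ok T).
  by apply: (iffP and5P) => [[? ? /dinjectiveP ? /dinjectiveP ? /dinjectiveP ?]|
    [? ? [? ? ?]]]; do ?split=> //; apply/dinjectiveP.
have ok0 : ok set0.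
  by apply/okP; rewrite imset0 !sub0set; split=> //; split=> x y; rewrite inE.
case: (arg_maxnP (fun T : {set X} => #|T|) ok0) => T /okP[TH TA trT] Tmax.
exists T; split=> //; apply: deficiency_maximal (rb) (rc) (rowd) _ TH TA trT _.
by move=> T' *; apply: Tmax; apply/okP.
Qed.

(** Each edge chosen earlier blocks at most one edge of the current row by its column and one by its
    colour, so fewer than [2 * size s] are lost. *)
Lemma greedy_transversal H (s : seq I) : uniq s ->
  {in H &, forall x y, r x = r y -> b x = b y -> x = y} ->
  {in H &, forall x y, r x = r y -> c x = c y -> x = y} ->
  {in s, forall a, 2 * size s <= #|row H a|} ->
  exists T, [/\ T \subset H, transversal T & r @: T =i s].
Proof.
move=> + rb rc; elim: s => [_ _|a s IHs /= /andP[as_ us] rows].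
  exists set0; rewrite sub0set; split=> //; first by split=> x y; rewrite inE.
  by move=> x; rewrite imset0 inE.
have [|T [TH trT rT]] := IHs us.
  move=> a' a's; apply: leq_trans (rows a' _); first by lia.
  by rewrite inE a's orbT.
have [trr trb trc] := trT.
have cardT : #|T| = size s by rewrite -(card_in_imset trr) (eq_card rT); apply/card_uniqP.
have small (Y : finType) (f : X -> Y) :
    {in H &, forall x y, r x = r y -> f x = f y -> x = y} ->
    #|[set x in row H a | f x \in f @: T]| <= size s.
  move=> fi; rewrite -cardT -(@card_in_imset _ _ f); last first.
    move=> y z; rewrite !inE => /andP[/andP[yH /eqP ry] _] /andP[/andP[zH /eqP rz] _].
    by apply: fi => //; rewrite ry rz.
  apply: leq_trans (leq_imset_card f T); apply/subset_leq_card/subsetP.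
  by move=> _ /imsetP[y + ->]; rewrite inE => /andP[].
pose Wb := [set x in row H a | b x \in b @: T].
pose Wc := [set x in row H a | c x \in c @: T].
have : 0 < #|row H a :\: (Wb :|: Wc)|.
  have := rows a (mem_head _ _); have := small _ _ rb; have := small _ _ rc.
  rewrite -/Wb -/Wc /= -(cardsID (Wb :|: Wc) (row H a)).
  have := subset_leq_card (subsetIr (row H a) (Wb :|: Wc)).
  have [+ _] := leq_card_setU Wb Wc; lia.
case/card_gt0P=> x; rewrite !inE => /andP[+ /andP[xH /eqP rx]].
rewrite xH rx eqxx /= => /norP[bx cx].
exists (x |: T); split.
- by rewrite subUset sub1set xH.
- apply: transversalU1 => // y yT; split.
  + by apply: contraNneq as_ => E; rewrite -rT -rx -E imset_f.
  + by apply: contraNneq bx => <-; rewrite imset_f.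
  + by apply: contraNneq cx => <-; rewrite imset_f.
- by move=> y; rewrite imsetU1 !inE rx rT.
Qed.

End RainbowTransversals.

(** * Random sampling by conditional expectations *)

(* The right-hand side is the expectation of the left-hand side over a random
   [Y] containing each point independently with probability [p]. *)
Lemma derandomize (F : realFieldType) (X : eqType) (J : finType) (p : F)
    (u : J -> X -> bool -> F) (s : seq X) :
  0 <= p <= 1 -> uniq s -> forall w : J -> F, exists Y : pred X,
  \sum_j w j * \prod_(x <- s) u j x (Y x) <=
  \sum_j w j * \prod_(x <- s) (p * u j x true + (1 - p) * u j x false).
Proof.
move=> /andP[p0 p1]; elim: s => [_ w|x s IHs /= /andP[xs us] w].
  by exists pred0; apply: ler_sum => j _; rewrite !big_nil.
pose Q j := \prod_(y <- s) (p * u j y true + (1 - p) * u j y false).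
pose S t := \sum_j w j * u j x t * Q j.
(* The target is the [p]-average of the conditional expectations [S true] and [S false]; the smaller
   one fixes the choice at [x]. *)
have [t le_t] : exists t, S t <= \sum_j w j *
    \prod_(y <- x :: s) (p * u j y true + (1 - p) * u j y false).
  have -> : \sum_j w j *
      \prod_(y <- x :: s) (p * u j y true + (1 - p) * u j y false) =
      p * S true + (1 - p) * S false.
    rewrite /S !mulr_sumr -big_split; apply: eq_bigr => j _ /=.
    by rewrite big_cons -/(Q j); ring.
  by case: (lerP (S true) (S false)) => h; [exists true|exists false]; nra.
have [Y le_Y] := IHs us (fun j => w j * u j x t).
exists (fun y => if y == x then t else Y y).
apply: le_trans le_t; apply: le_trans le_Y; rewrite le_eqVlt; apply/orP; left.
apply/eqP/eq_bigr => j _; rewrite big_cons eqxx mulrA; congr (_ * _).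
by apply: eq_big_seq => y ys; rewrite ifN //; apply: contraNneq xs => <-.
Qed.

(** Raising [k] by one does not increase the product, since
    [(1 - m) * (1 + (k + 1) * m) <= 1 + k * m]. *)
Lemma pow_le_inv_linear (F : realFieldType) (m : F) k :
  0 <= m <= 1 -> (1 - m) ^+ k * (1 + k%:R * m) <= 1.
Proof.
move=> /andP[m0 m1]; elim: k => [|k IHk]; first by rewrite expr0; lra.
apply: le_trans IHk; rewrite exprSr -mulrA ler_wpM2l ?exprn_ge0 ?subr_ge0 //.
have := ler0n F k; rewrite -natr1; nra.
Qed.

(** Each half of the power pays for a linear factor, and their quadratic product outgrows
    [2 * q + 1]. This serves a union bound over at most [2 * q] bad events. *)
Lemma geometric_decay (m : rat) (K : nat) : 0 < m <= 1 ->
  exists N, forall q n : nat, (N <= q)%N -> (q <= K * n)%N ->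
  (1 - m) ^+ n * (2 * q + 1)%:R <= 1.
Proof.
move=> /andP[m0 m1]; pose M := Num.bound m^-1.
have Mm : 1 <= M%:R * m.
  have h : m^-1 < M%:R by rewrite archi_boundP // invr_ge0 ltW.
  by rewrite -ler_pdivrMr // div1r ltW.
(* This forces [k > 9 * K * M ^ 2]; as [M * m >= 1], it follows that
   [(k * m) ^ 2 >= 9 * K * k >= 2 * q + 1]. *)
exists (K * (18 * K * M ^ 2 + 2)).+1 => q n Nq qK; pose k := (n %/ 2)%N.
have nk : (2 * k <= n <= 2 * k + 1)%N by rewrite /k; lia.
have kM : (9 * K * M ^ 2 < k)%N.
  have : (18 * K * M ^ 2 + 2 < n)%N.
    by rewrite -(ltn_pmul2l (m := K)); lia.
  lia.
have K0 : (0 < K)%N by case: (K) Nq qK => //; lia.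
have q9 : (2 * q + 1 <= 9 * K * k)%N by nia.
have {}q9 : (2 * q + 1)%:R <= 9 * K%:R * k%:R :> rat.
  by rewrite -!natrM ler_nat.
have {}kM : 9 * K%:R * M%:R ^+ 2 <= k%:R :> rat.
  by rewrite -natrX -!natrM ler_nat ltnW.
have kk : (2 * q + 1)%:R <= (k%:R * m) ^+ 2.
  have k0 := ler0n rat k; have KK := ler0n rat K.
  have : 9 * K%:R <= k%:R * m ^+ 2.
    apply: le_trans (ler_wpM2r (sqr_ge0 m) kM).
    have -> : 9 * K%:R * M%:R ^+ 2 * m ^+ 2 = 9 * K%:R * (M%:R * m) ^+ 2 by ring.
    by rewrite ler_peMr ?mulr_ge0 // exprn_ege1.
  move=> /(ler_wpM2r k0) h; apply: le_trans q9 (le_trans h _).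
  by rewrite exprMn expr2 mulrAC.
have Mk := @pow_le_inv_linear _ m k; rewrite (ltW m0) m1 in Mk.
have {}Mk := Mk isT.
have l0 : 0 <= 1 - m by lra.
have l1 : 1 - m <= 1 by lra.
have km : 0 <= k%:R * m by rewrite mulr_ge0 // ltW.
have lk : 0 <= (1 - m) ^+ k by exact: exprn_ge0.
have : (1 - m) ^+ n <= ((1 - m) ^+ k) ^+ 2.
  rewrite -exprM mulnC ler_wiXn2l //; by case/andP: nk.
move=> h; apply: (le_trans (ler_wpM2r (ler0n _ _) h)).
apply: (le_trans (ler_wpM2l (sqr_ge0 _) kk)).
rewrite -exprMn expr_le1 ?mulr_ge0 //; nra.
Qed.

Lemma prod_split (F : realFieldType) (X : finType) (S Y : {set X}) (y z : F) :
  \prod_(x in S) (if x \in Y then y else z) =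
  y ^+ #|S :&: Y| * z ^+ #|S :\: Y|.
Proof.
rewrite (big_setID Y) /=; congr (_ * _).
  by rewrite -prodr_const; apply: eq_bigr => x /setIP[_ ->].
by rewrite -prodr_const; apply: eq_bigr => x /setDP[_ /negPf->].
Qed.

(* An exponential moment argument: [upper] and [lower] are at least 1 on the
   bad events, and their expected total is less than 1. *)
Lemma sampling (h K : nat) : (0 < h)%N ->
  exists N, forall q, (N <= q)%N ->
  forall (X I : finType) (A : {set I}) (U L : I -> {set X}), (#|A| <= q)%N ->
  {in A, forall i, q <= K * #|U i| /\ q <= K * #|L i|}%N ->
  exists Y : {set X}, {in A, forall i, h * #|U i :&: Y| <= #|U i| /\
    #|L i| <= (2 ^ (h + 2)).+1 * #|L i :&: Y|}%N.
Proof.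
move=> h0; pose p : rat := (2 ^+ (h + 1))^-1.
have p0 : 0 < p by rewrite invr_gt0 exprn_gt0.
have p4 : p <= 4^-1.
  rewrite /p lef_pV2 ?posrE ?exprn_gt0 //.
  have -> : 4 = 2 ^+ 2 :> rat by [].
  by rewrite ler_eXn2l //; lia.
have ph : p * 2 ^+ h.-1 = 4^-1.
  rewrite /p; have -> : (h + 1 = h.-1 + 2)%N by lia.
  by rewrite exprD; field; rewrite expf_neq0.
have [|N HN] := @geometric_decay (p ^+ 2 / 2) K; first by nra.
exists N => q Nq X I A U L Aq UL.
pose S (j : I * bool) := if j.2 then U j.1 else L j.1.
(* Weight of a point, by kind of event and membership in [Y]. For upper events the product is at
   least 1 once [#|U i| <= h * #|U i :&: Y|], and the mean weight is [3/4 - p / 2]; for lower events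
   the mean is exactly [1 - p ^ 2 / 2]. *)
pose v (t y : bool) : rat :=
  if t then (if y then 2 ^+ h.-1 else 2^-1) else (if y then 2^-1 else 1 + p / 2).
have v0 t y : 0 < v t y.
  by case: t; case: y; rewrite /v ?exprn_gt0 //; lra.
pose u (j : I * bool) x y := if x \in S j then v j.2 y else 1.
pose w (j : I * bool) : rat := (j.1 \in A)%:R.
have [|Y leY] := @derandomize _ X _ p u (enum X) _ (enum_uniq X) w; first by lra.
have S_ge j : j.1 \in A -> (q <= K * #|S j|)%N.
  by case: j => i [] /= /UL[].
(* Each expected product is at most [1 / (2 * q + 1)], and at most [2 * q] indices have nonzero
   [w]. *)
have sum_lt1 : \sum_j w j * \prod_(x <- enum X)
    (p * u j x true + (1 - p) * u j x false) < 1.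
  have q0 : 0 < (2 * q + 1)%:R :> rat by rewrite ltr0n addn1.
  apply: (@le_lt_trans _ _ (\sum_j w j * ((2 * q + 1)%:R)^-1)).
    apply: ler_sum => j _; rewrite /w; have [jA|] := boolP (j.1 \in A); last by rewrite !mul0r.
    rewrite !mul1r -[leRHS]mul1r ler_pdivlMr //.
    apply: le_trans (HN q #|S j| Nq (S_ge j jA)).
    rewrite ler_wpM2r ?ler0n // big_enum /= -prodr_const big_mkcond /= [leRHS]big_mkcond /=.
    apply: ler_prod => x _; rewrite /u; case: ifP => _; last by lra.
    by rewrite /v; case: (j.2); nra.
  rewrite -mulr_suml ltr_pdivrMr // mul1r.
  have -> : \sum_j w j = (2 * #|A|)%:R.
    rewrite /w -natr_sum; congr _%:R.
    rewrite -(pair_bigA _ (fun i _ => (i \in A) : nat)) /=.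
    under eq_bigr do rewrite sum_nat_const card_bool.
    by rewrite -big_distrr /= -big_mkcond sum1_card.
  by rewrite ltr_nat; lia.
have {leY} bad_lt1 j : j.1 \in A ->
    v j.2 true ^+ #|S j :&: [set x | Y x]| * v j.2 false ^+ #|S j :\: [set x | Y x]| < 1.
  move=> jA; rewrite -prod_split; apply: le_lt_trans sum_lt1; apply: le_trans leY.
  rewrite (bigD1 j) //= -[leLHS]addr0 lerD ?sumr_ge0 //.
    rewrite /w jA mul1r big_enum /= big_mkcond /=; apply: ler_prod => x _.
    by rewrite /u !inE; case: ifP => _; case: (Y x); rewrite ?lexx ?ltW.
  move=> k _; rewrite mulr_ge0 ?ler0n // prodr_ge0 // => x _.
  by rewrite /u; case: ifP => _; rewrite ?ltW.
exists [set x | Y x] => i iA; split.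
  have := bad_lt1 (i, true) iA; rewrite /S /v /=.
  rewrite -(cardsID [set x | Y x] (U i)); set k := #|_|; set l := #|_| => lt1.
  rewrite leqNgt; apply/negP=> lkl; move: lt1; apply/negP; rewrite -leNgt.
  rewrite exprVn ler_pdivlMr ?exprn_gt0 // mul1r -exprM ler_eXn2l //.
  by rewrite -ltnS; case: (h) h0 lkl => //= h' _; lia.
have := bad_lt1 (i, false) iA; rewrite /S /v /=.
rewrite -(cardsID [set x | Y x] (L i)); set k := #|_|; set l := #|_| => lt1.
rewrite leqNgt; apply/negP=> lkl; move: lt1; apply/negP; rewrite -leNgt.
have hk : (2 ^ (h + 2) * k <= l)%N by lia.
(* The exponent is [2 / p]: by Bernoulli, that many factors [1 + p / 2] offset one factor [1/2]. *)
have two : 2 <= (1 + p / 2) ^+ (2 ^ (h + 2)).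
  have Hb : 1 + (2 ^ (h + 2))%:R * (p / 2) <= (1 + p / 2) ^+ (2 ^ (h + 2)).
    elim: (2 ^ (h + 2))%N => [|n IHn]; first by rewrite expr0; lra.
    by rewrite exprS -natr1; have := ler0n rat n; nra.
  apply: le_trans Hb; rewrite natrX.
  have -> : (h + 2 = (h + 1).+1)%N by lia.
  rewrite exprS.
  have : 2 ^+ (h + 1) * p = 1 by rewrite mulfV ?expf_neq0.
  by nra.
have l1 : 1 <= 1 + p / 2 by lra.
rewrite exprVn mulrC ler_pdivlMr ?exprn_gt0 // mul1r.
apply: le_trans (ler_weXn2l l1 hk); rewrite exprM.
by apply: lerXn2r; rewrite ?nnegrE ?(le_trans _ two).
Qed.

(** * Covering every row, outside and inside the sample *)

Lemma card_imsetI (X Y : finType) (f : X -> Y) (S : {set X}) (Z : {set Y}) :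
  {in S &, injective f} -> #|f @: S :&: Z| = #|[set x in S | f x \in Z]|.
Proof.
move=> injf; rewrite -(@card_in_imset _ _ f); last first.
  by move=> x y; rewrite !inE => /andP[xS _] /andP[yS _]; apply: injf.
apply: eq_card => y; rewrite inE; apply/andP/imsetP.
  by move=> [/imsetP[x xS ->] fZ]; exists x; rewrite ?inE ?xS.
by move=> [x + ->]; rewrite inE => /andP[xS fZ]; rewrite imset_f.
Qed.

Lemma full_transversal (m : nat) : (0 < m)%N ->
  exists N, forall (X I B C : finType) (r : X -> I) (b : X -> B) (c : X -> C)
    (H : {set X}) (A : {set I}), (N <= #|A|)%N ->
  {in H &, forall x y, r x = r y -> b x = b y -> x = y} ->
  {in H &, forall x y, r x = r y -> c x = c y -> x = y} ->
  {in A, forall a, m.+1 * #|A| <= m * #|row r H a|}%N ->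
  exists T : {set X}, [/\ T \subset H, transversal r b c T & r @: T = A].
Proof.
(* Avoiding both samples costs a row at most [2 / h = 1 / (2 * m.+1)] of its edges, which turns the
   surplus factor [1 + 1 / m] into [1 + 1 / (2 * m)]. Each sample keeps at least a share [1 / k] of
   its target. *)
move=> m0; pose h := (4 * m.+1)%N; pose k := (2 ^ (h + 2)).+1.
have [N1 HN1] := @sampling h 1 isT; have [N2 HN2] := @sampling h k isT.
exists (N1 + N2 + 4 * m + 8 * m * (k * k))%N.
move=> X I B C r b c H A; set q := #|A| => Nq rb rc rowge.
have binj a : {in row r H a &, injective b}.
  move=> y z; rewrite !inE => /andP[yH /eqP ry] /andP[zH /eqP rz].
  by apply: rb => //; rewrite ry rz.
have cinj a : {in row r H a &, injective c}.
  move=> y z; rewrite !inE => /andP[yH /eqP ry] /andP[zH /eqP rz].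
  by apply: rc => //; rewrite ry rz.
have qrow a : a \in A -> (q <= #|row r H a|)%N.
  by move=> /rowge h'; rewrite -(leq_pmul2l m0); lia.
have [|||B' HB'] := HN1 q _ B I A (fun a => b @: row r H a) (fun a => b @: row r H a).
- by lia.
- by [].
- by move=> a /qrow; rewrite mul1n card_in_imset.
pose HB a := [set x in row r H a | b x \in B'].
have HBr a : HB a \subset row r H a by apply/subsetP=> x; rewrite inE => /andP[].
have cHB a : {in HB a &, injective c}.
  by move=> x y /(subsetP (HBr a)) xr /(subsetP (HBr a)); apply: cinj.
(* Colours are sampled after columns, so that the lower bound can be imposed on [HB a], the edges of
   row [a] with sampled column. *)
have [|||C' HC'] := HN2 q _ C I A (fun a => c @: row r H a) (fun a => c @: HB a).
- by lia.
- by [].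
- move=> a aA; rewrite !card_in_imset //; have := qrow a aA.
  have [_] := HB' a aA; rewrite card_imsetI // card_in_imset // -/(HB a) -/k.
  by split; nia.
pose H' := [set x in H | (b x \notin B') && (c x \notin C')].
pose R := [set x in H | (b x \in B') && (c x \in C')].
have H'H : H' \subset H by apply/subsetP=> x; rewrite inE => /andP[].
have RH : R \subset H by apply/subsetP=> x; rewrite inE => /andP[].
(* Two samples keep a share [1 / k ^ 2] of the row; [8 * m] is twice the bound [4 * m] on missed
   rows, as the greedy completion requires. *)
have rowR a : a \in A -> (8 * m <= #|row r R a|)%N.
  move=> aA; have qa := qrow a aA.
  have [_] := HB' a aA; rewrite card_imsetI // card_in_imset // -/(HB a) -/k => hB.
  have [_] := HC' a aA; rewrite card_imsetI // card_in_imset // -/k => hC.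
  have E : [set x in HB a | c x \in C'] = row r R a.
    by apply/setP=> x; rewrite !inE; do !case: (_ \in _); rewrite ?andbT ?andbF.
  rewrite E in hC; rewrite -(@leq_pmul2r (k * k)); last by rewrite muln_gt0.
  have : (8 * m * (k * k) <= q)%N by lia.
  have := leq_mul (leqnn k) hC; lia.
have rowH' a : a \in A -> (q + q %/ (2 * m) <= #|row r H' a|)%N.
  move=> aA; have mq := rowge a aA.
  have [hB _] := HB' a aA; have [hC _] := HC' a aA; move: hB hC.
  rewrite !card_imsetI // !card_in_imset //.
  set D := #|row r H a| in mq *; set d' := #|row r H' a|.
  rewrite -/(HB a); set HC := [set x in row r H a | c x \in C'] => hy hz.
  have Dd : (D <= d' + #|HB a| + #|HC|)%N.
    have sub : row r H a \subset row r H' a :|: HB a :|: HC.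
      apply/subsetP=> x; rewrite !inE => /andP[-> ->] /=.
      by case: (b x \in B'); case: (c x \in C').
    apply: leq_trans (subset_leq_card sub) _.
    have [+ _] := leq_card_setU (row r H' a :|: HB a) HC.
    by have [+ _] := leq_card_setU (row r H' a) (HB a); lia.
  have : (2 * m * q + q <= 2 * m * d')%N.
    have h1 : ((2 * m + 1) * D <= 2 * m.+1 * d')%N.
      have := leq_mul (leqnn h) Dd; rewrite !(mulnDr h) => h4.
      have := leq_trans h4 (leq_add (leq_add (leqnn _) hy) hz).
      by rewrite /h; lia.
    have h2 := leq_mul (leqnn m) h1.
    have h3 := leq_mul (leqnn (2 * m + 1)) mq.
    by rewrite -(@leq_pmul2l m.+1) //; lia.
  move=> le; rewrite -(@leq_pmul2l (2 * m)) ?muln_gt0 //; apply: leq_trans le.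
  by rewrite mulnDr leq_add2l mulnC leq_trunc_div.
have sub_in2H (G : {set X}) (P : X -> X -> Prop) : G \subset H ->
    {in H &, forall x y, P x y} -> {in G &, forall x y, P x y}.
  by move=> /subsetP GH HP x y /GH xH /GH; apply: HP.
have [|||T0 [T0H T0A trT0 few]] := @almost_transversal _ _ _ _ r b c H' A (q + q %/ (2 * m)).
- exact: sub_in2H H'H rb.
- exact: sub_in2H H'H rc.
- exact: rowH'.
rewrite -/q addKn in few; set W := A :\: _ in few.
(* With [n = q %/ (2 * m)] positive, [#|W| * n <= q < 2 * m * (n + 1) <= 4 * m * n]. *)
have {}few : (#|W| <= 4 * m)%N.
  rewrite leqNgt; apply/negP=> gt; have := ltn_ceil q (_ : 0 < 2 * m)%N.
  rewrite muln_gt0 m0 => /(_ isT).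
  have e0 : (0 < q %/ (2 * m))%N by rewrite divn_gt0 ?muln_gt0 //; lia.
  have := leq_mul gt (leqnn (q %/ (2 * m))); nia.
have [|||T1 [T1R trT1 rT1]] := @greedy_transversal _ _ _ _ r b c R (enum W) (enum_uniq _).
- exact: sub_in2H RH rb.
- exact: sub_in2H RH rc.
- move=> a; rewrite mem_enum => /setDP[/rowR + _]; rewrite -cardE; lia.
exists (T0 :|: T1); split.
- by rewrite subUset (subset_trans T0H) // (subset_trans T1R).
- apply: transversalU => // x y xT yT.
  have := subsetP T0H x xT; have := subsetP T1R y yT; rewrite !inE.
  move=> /and3P[_ by_ cy] /and3P[_ bx cx]; split.
  + apply/eqP=> E; have : r y \in W by rewrite -mem_enum -rT1 imset_f.
    by rewrite inE -E imset_f.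
  + by apply: contraNneq bx => ->.
  + by apply: contraNneq cx => ->.
- apply/setP=> a; rewrite imsetU inE rT1 mem_enum inE.
  by case: (boolP (a \in r @: T0)) => //= /(subsetP T0A) ->.
Qed.

(** * From edge-coloured bipartite graphs to triples *)

Theorem theorem1p12 (R : realType) (eps : R) (heps : 0 < eps) :
  exists N : nat, forall q : nat, (N <= q)%N ->
  forall (V : finType) (e : rel V) (A B : {set V}) (C : eqType)
         (c : {set V} -> C),
    simple_graph e ->
    bipartition e A B ->
    #|A| = q ->
    (forall a, a \in A -> (1 + eps) * q%:R <= (degree e a)%:R) ->
    proper_edge_coloring e c ->
    exists M : {set {set V}},
      [/\ matching e M, rainbow c M & A \subset cover M].
Proof.
(* Then [1 / m < eps], so the degree condition yields the integral form
   [m.+1 * q <= m * degree e a]. *)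
pose m := Num.bound eps^-1.
have meps : eps^-1 < m%:R by rewrite archi_boundP // invr_ge0 ltW.
have m0 : (0 < m)%N.
  by rewrite -(ltr_nat R); apply: le_lt_trans meps; rewrite invr_ge0 ltW.
have [N HN] := full_transversal m0.
exists N => q Nq V e A B C c [e_sym e_irr] [_ AB eAB] Aq deg proper.
(* [C] need not be finite: each colour is represented by an edge of that colour. *)
pose rep (f : {set V}) := odflt f [pick g | c g == c f].
have rep_c f : c (rep f) = c f by rewrite /rep; case: pickP => //= g /eqP.
have rep_eq f g : c f = c g -> rep f = rep g.
  rewrite /rep => ->; case: pickP => //= /(_ g); by rewrite eqxx.
pose edge (x : V * V) : {set V} := [set x.1; x.2].
(* Orienting edges out of [A] represents each one once, with its row as first coordinate. *)
pose H := [set x : V * V | (x.1 \in A) && e x.1 x.2].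
have HE x : x \in H -> edge x \in edges e.
  by rewrite inE => /andP[_ exy]; apply/imsetP; exists x; rewrite ?inE.
have HAB x : x \in H -> x.1 \in A /\ x.2 \notin A.
  rewrite inE => /andP[xA /eAB[[_ xB]|[xB _]]]; split=> //.
    by apply: contraTN xB => yA; rewrite (disjointFr AB).
  by move: xB; rewrite (disjointFr AB).
have edge_inj : {in H &, injective edge}.
  move=> x y xH yH E; have [xA xB] := HAB x xH; have [yA yB] := HAB y yH.
  have : x.1 \in edge y by rewrite -E !inE eqxx.
  rewrite !inE => /orP[/eqP E1|/eqP E1]; last by rewrite E1 (negPf yB) in xA.
  have : x.2 \in edge y by rewrite -E !inE eqxx orbT.
  rewrite !inE => /orP[/eqP E2|/eqP E2]; first by rewrite E2 yA in xB.
  by case: x y E1 E2 {xH yH E xA xB yA yB} => ? ? [? ?] /= -> ->.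
have [||||T [TH [trr trb trc] rT]] := HN _ _ _ _ (fst : V * V -> V) snd (rep \o edge) H A.
- by rewrite Aq.
- by move=> [x1 x2] [y1 y2] _ _ /= -> ->.
- move=> x y xH yH E /= Ec; have {}Ec : c (edge x) = c (edge y).
    by rewrite -rep_c Ec rep_c.
  apply: edge_inj => //; apply/eqP; apply: contraT => ne.
  have : edge x :&: edge y != set0.
    by apply/set0Pn; exists x.1; rewrite !inE eqxx E eqxx.
  by move/(proper _ _ (HE x xH) (HE y yH) ne); rewrite Ec eqxx.
- move=> a aA; have := deg a aA; rewrite Aq.
  have -> : degree e a = #|row fst H a|.
    rewrite /degree -(card_imset _ (_ : injective (pair a))); last by move=> ? ? [].
    apply: eq_card => -[y z]; rewrite !inE /=; apply/imsetP/andP.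
      by move=> [w]; rewrite inE => aw [-> ->]; rewrite aA aw.
    by move=> [/andP[_ yz] /eqP <-]; exists z; rewrite ?inE.
  set D := #|_| => hD; rewrite -(ler_nat R) !natrM -natr1.
  have em : 1 <= m%:R * eps by rewrite -ler_pdivrMr // div1r ltW.
  have q0 := ler0n R q; have mm := ler0n R m.
  apply: le_trans (ler_wpM2l mm hD).
  have := ler_wpM2r q0 em; lra.
exists (edge @: T).
have TE x : x \in T -> x \in H by move/(subsetP TH).
split.
- split; first by apply/subsetP=> _ /imsetP[x /TE xH ->]; apply: HE.
  apply/trivIsetP=> _ _ /imsetP[x xT ->] /imsetP[y yT ->] ne.
  have [xA xB] := HAB x (TE x xT); have [yA yB] := HAB y (TE y yT).
  have nxy : x != y by apply: contraNneq ne => ->.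
  rewrite disjoints_subset; apply/subsetP=> z; rewrite !inE negb_or.
  case/orP=> /eqP ->; apply/andP; split.
  + by apply: contraNneq nxy => E; apply/eqP/trr.
  + by apply: contraNneq yB => <-.
  + by apply: contraNneq xB => ->.
  + by apply: contraNneq nxy => E; apply/eqP/trb.
- move=> _ _ /imsetP[x xT ->] /imsetP[y yT ->] E.
  by rewrite (trc x y xT yT _) //=; apply: rep_eq.
- apply/subsetP=> a; rewrite -rT => /imsetP[x xT ->].
  by apply/bigcupP; exists (edge x); rewrite ?imset_f // !inE eqxx.
Qed.
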